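(* Let $\tau$ be an embedding-continuous structure. If $\tau$ is stably metrizable, then the local GH-type topology with preserved roots and the local GH-type topology with non-preserved roots on $\mathfrak{M}_\bullet(\tau)$ coincide.
   Context: A bcm (boundedly-compact metric) space is a non-empty metric space in which every closed ball of finite radius is compact; a rooted bcm space $(X,\rho_X)$ is a bcm space $X$ with a distinguished point $\rho_X$. The metric of $X$ is denoted $d_X$, and $D_X(x,r)=\{y: d_X(x,y)\le r\}$. An isometric embedding is a distance-preserving map (not necessarily onto); an isometry is a bijective one; a map is root-preserving if it sends root to root. A topological embedding is a homeomorphism onto its image. Structure: a functor $\tau$ from the category of bcm spaces (morphisms: isometric embeddings) to the category of metrizable topological spaces (morphisms: topological embeddings). That is, to each bcm space $X$ it assigns a metrizable space $\tau(X)$ and to each isometric embedding $f\colon X\to Y$ a topological embedding $\tau_f\colon\tau(X)\to\tau(Y)$, with $\tau_{\mathrm{id}_X}=\mathrm{id}_{\tau(X)}$ and $\tau_{g\circ f}=\tau_g\circ\tau_f$. $\tau$ is embedding-continuous if, whenever $X,Y$ are bcm spaces and $f_n\colon X\to Y$, $n\in\mathbb{N}\cup\{\infty\}$, are isometric embeddings with $f_n\to f_\infty$ uniformly on compact sets, one has $\tau_{f_n}(a)\to\tau_{f_\infty}(a)$ in $\tau(Y)$ for all $a\in\tau(X)$. $\mathfrak{M}_\bullet(\tau)$: the set of (representatives of) equivalence classes of triples $(X,\rho_X,a_X)$, with $(X,\rho_X)$ a rooted bcm space and $a_X\in\tau(X)$, where $(X,\rho_X,a_X)\sim(Y,\rho_Y,a_Y)$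 iff there is a root-preserving isometry $f\colon X\to Y$ with $\tau_f(a_X)=a_Y$. Element-rooted metrization $\tau^{\mathrm{erm}}$: a choice, for each bcm space $X$, of a metric $d^{\tau^{\mathrm{erm}}}_{X}$ on $\tau(X)\times X$ inducing the product topology such that $\tau_f\times f$ is distance-preserving for every isometric embedding $f\colon X\to Y$. It is stable if there is $\Theta\colon[0,\infty)\to[0,\infty)$ with $\lim_{\varepsilon\to0}\Theta(\varepsilon)=\Theta(0)=0$ such that: for all bcm spaces $X,Y,M_1,M_2$, isometric embeddings $f_i\colon X\to M_i$, $g_i\colon Y\to M_i$ ($i=1,2$) and $\varepsilon\ge 0$ with $d_{M_2}(f_2(x),g_2(y))\le d_{M_1}(f_1(x),g_1(y))+\varepsilon$ for all $x\in X,y\in Y$, one has $$d^{\tau^{\mathrm{erm}}}_{M_2}\bigl((\tau_{f_2}(a),f_2(x)),(\tau_{g_2}(b),g_2(y))\bigr)\le d^{\tau^{\mathrm{erm}}}_{M_1}\bigl((\tau_{f_1}(a),f_1(x)),(\tau_{g_1}(b),g_1(y))\bigr)+\Theta(\varepsilon)$$ for all $(a,x)\in\tau(X)\times X$, $(b,y)\in\tau(Y)\times Y$. The structure $\tau$ is stably metrizable if it admits a stable element-rooted metrization. Hausdorff metric on compact subsets (including $\emptyset$) of a metric space $M$: $d^H_M(A,B)=\inf\{\varepsilon\ge0: A\subseteq B^\varepsilon, B\subseteq A^\varepsilon\}$, where $A^\varepsilon=\{x:\exists y\in A, d_M(x,y)\le\varepsilon\}$ and $\inf\emptyset=\infty$.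 For a bcm space $M$, closed $A,B\subseteq M$ and $x,y\in M$, $$d^F_{M}((A,x),(B,y))=d_M(x,y)\vee\int_0^\infty e^{-r}\bigl(1\wedge d^H_M(A\cap D_M(x,r),B\cap D_M(y,r))\bigr)dr,$$ and $d^F_{M,\rho}(A,B)=d^F_M((A,\rho),(B,\rho))$. The local GH-type topology with non-preserved roots is the topology on $\mathfrak{M}_\bullet(\tau)$ induced by the metric $$\check d_{\mathfrak{M}_\bullet}^{\tau^{\mathrm{erm}}}(\mathcal{X},\mathcal{Y})=\inf_{f,g,Z}\bigl\{d^F_{Z}\bigl((f(X),f(\rho_X)),(g(Y),g(\rho_Y))\bigr)\vee d^{\tau^{\mathrm{erm}}}_{Z}\bigl((\tau_f(a_X),f(\rho_X)),(\tau_g(a_Y),g(\rho_Y))\bigr)\bigr\}$$ (infimum over bcm spaces $Z$ and isometric embeddings $f\colon X\to Z$, $g\colon Y\to Z$), and the local GH-type topology with preserved roots is the one induced by the metric $$d_{\mathfrak{M}_\bullet}^{\tau^{\mathrm{erm}}}(\mathcal{X},\mathcal{Y})=\inf_{f,g,Z}\bigl\{d^F_{Z,\rho_Z}(f(X),g(Y))\vee d^{\tau^{\mathrm{erm}}}_{Z}\bigl((\tau_f(a_X),\rho_Z),(\tau_g(a_Y),\rho_Z)\bigr)\bigr\}$$ (infimum over rooted bcm spaces $(Z,\rho_Z)$ and root-preserving isometric embeddings $f\colon X\to Z$, $g\colon Y\to Z$), for $\mathcal{X}=(X,\rho_X,a_X)$, $\mathcal{Y}=(Y,\rho_Y,a_Y)$.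 For embedding-continuous $\tau$ these are metrics and the topologies do not depend on the choice of the element-rooted metrization. *)

(* Defs.v *)
From HB Require Import structures.
From mathcomp Require Import all_boot all_order all_algebra.
From mathcomp Require Import all_classical all_reals all_analysis.

Set Implicit Arguments.
Unset Strict Implicit.
Unset Printing Implicit Defensive.

Import Order.TTheory GRing.Theory Num.Theory.
Import numFieldTopology.Exports.

Local Open Scope classical_set_scope.
Local Open Scope ring_scope.

(* The open sets of the topology induced by a distance.  Distances are
   extended-real valued here, so that infima need no side condition.  The type
   is [set_system T] unfolded: as a constant, [set_system] lives in too small a
   universe for the type [gh_classes] below. *)
Definition dist_open (R : realType) (T : Type) (d : T -> T -> \bar R) :
    (T -> Prop) -> Prop :=
  fun U => forall x, U x -> exists2 e : R, 0 < e &
             forall y, (d x y < e%:E)%E -> U y.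

Definition is_metric (R : realType) (T : Type) (d : T -> T -> R) : Prop :=
  [/\ forall x, d x x = 0,
      forall x y, d x y = 0 -> x = y,
      forall x y, d x y = d y x &
      forall y x z, d x z <= d x y + d y z].

Definition metrizes (R : realType) (T : topologicalType) (d : T -> T -> R) :
    Prop :=
  is_metric d /\ @open T = dist_open (fun x y => (d x y)%:E).

Definition metrizable (R : realType) (T : topologicalType) : Prop :=
  exists d : T -> T -> R, metrizes d.

Definition top_embedding (S T : topologicalType) (f : S -> T) : Prop :=
  [/\ injective f, continuous f &
      forall U, open U -> exists2 V, open V & f @` U = V `&` range f].

(* The library's [closed_ball] is the closure of the open ball, which may be
   strictly smaller. *)
Definition cball (R : realType) (X : metricType R) (x : X) (r : R) : set X :=
  [set y | mdist x y <= r].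

Record bcmType (R : realType) := BcmType {
  bcm_sort :> metricType R;
  bcm_inhabited : inhabited bcm_sort;
  bcm_compact : forall (x : bcm_sort) (r : R), compact (cball x r)
}.

Record isoEmb (R : realType) (X Y : bcmType R) := IsoEmb {
  emb_fun :> X -> Y;
  embP : forall x y, mdist (emb_fun x) (emb_fun y) = mdist x y
}.

Definition emb_id (R : realType) (X : bcmType R) : isoEmb X X :=
  @IsoEmb R X X id (fun x y => erefl).

Lemma emb_comp_proof (R : realType) (X Y Z : bcmType R)
    (g : isoEmb Y Z) (f : isoEmb X Y) x y :
  mdist ((g \o f) x) ((g \o f) y) = mdist x y.
Proof. by rewrite /= !embP. Qed.

Definition emb_comp (R : realType) (X Y Z : bcmType R)
    (g : isoEmb Y Z) (f : isoEmb X Y) : isoEmb X Z :=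
  IsoEmb (emb_comp_proof g f).

Record structure (R : realType) := Structure {
  sobj :> bcmType R -> topologicalType;
  sobj_metrizable : forall X, metrizable R (sobj X);
  smap : forall X Y : bcmType R, isoEmb X Y -> sobj X -> sobj Y;
  smap_embedding : forall X Y (f : isoEmb X Y), top_embedding (smap f);
  smap_id : forall X, smap (emb_id X) = id;
  smap_comp : forall X Y Z (g : isoEmb Y Z) (f : isoEmb X Y),
    smap (emb_comp g f) = smap g \o smap f
}.

Definition embedding_continuous (R : realType) (tau : structure R) : Prop :=
  forall (X Y : bcmType R) (f : nat -> isoEmb X Y) (f_oo : isoEmb X Y),
    {family compact, (fun n => f n : X -> Y) @ \oo --> (f_oo : X -> Y)} ->
    forall a : tau X, smap (f n) a @[n --> \oo] --> smap f_oo a.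

Definition erm_family (R : realType) (tau : structure R) :=
  forall X : bcmType R, (tau X * X)%type -> (tau X * X)%type -> R.

Definition is_erm (R : realType) (tau : structure R) (d : erm_family tau) :
    Prop :=
  (forall X, metrizes (d X)) /\
  (forall (X Y : bcmType R) (f : isoEmb X Y) (a b : tau X) (x y : X),
     d Y (smap f a, f x) (smap f b, f y) = d X (a, x) (b, y)).

Definition stable_erm (R : realType) (tau : structure R) (d : erm_family tau) :
    Prop :=
  exists Theta : R -> R,
    [/\ forall e, 0 <= e -> 0 <= Theta e,
        Theta e @[e --> 0^'+] --> (0 : R),
        Theta 0 = 0 &
        forall (X Y M1 M2 : bcmType R)
               (f1 : isoEmb X M1) (g1 : isoEmb Y M1)
               (f2 : isoEmb X M2) (g2 : isoEmb Y M2) (e : R),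
          0 <= e ->
          (forall x y, mdist (f2 x) (g2 y) <= mdist (f1 x) (g1 y) + e) ->
          forall (a : tau X) (x : X) (b : tau Y) (y : Y),
            d M2 (smap f2 a, f2 x) (smap g2 b, g2 y)
              <= d M1 (smap f1 a, f1 x) (smap g1 b, g1 y) + Theta e].

Definition stably_metrizable (R : realType) (tau : structure R) : Prop :=
  exists d : erm_family tau, is_erm d /\ stable_erm d.

Record gh_triple (R : realType) (tau : structure R) := GHTriple {
  gh_space : bcmType R;
  gh_root : gh_space;
  gh_elt : tau gh_space
}.

Definition gh_equiv (R : realType) (tau : structure R)
    (x y : gh_triple tau) : Prop :=
  exists f : isoEmb (gh_space x) (gh_space y),
    [/\ bijective f, f (gh_root x) = gh_root y & smap f (gh_elt x) = gh_elt y].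

Section gh_classes.
Variables (R : realType) (tau : structure R).

Lemma gh_equiv_refl (x : gh_triple tau) : gh_equiv x x.
Proof.
exists (emb_id (gh_space x)); split=> //; first by exists id.
by rewrite smap_id.
Qed.

Lemma gh_equiv_sym (x y : gh_triple tau) : gh_equiv x y -> gh_equiv y x.
Proof.
move=> [f [[g fK gK] fr fa]].
have gP u v : mdist (g u) (g v) = mdist u v by rewrite -(embP f) !gK.
exists (IsoEmb gP); split => /=; first by exists f.
  by rewrite -fr fK.
have gf : emb_comp (IsoEmb gP) f = emb_id (gh_space x).
  have : emb_fun (emb_comp (IsoEmb gP) f) = emb_id (gh_space x).
    by apply/funext => u /=; rewrite fK.
  case: (emb_comp _ _) => h hP /= hE; rewrite /emb_id.
  by move: hP; rewrite hE => hP; congr IsoEmb; exact: Prop_irrelevance.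
by rewrite -fa -[LHS]/((smap (IsoEmb gP) \o smap f) _) -smap_comp gf smap_id.
Qed.

Lemma gh_equiv_trans (x y z : gh_triple tau) :
  gh_equiv x y -> gh_equiv y z -> gh_equiv x z.
Proof.
move=> [f [bf fr fa]] [g [bg gr ga]].
exists (emb_comp g f); split => /=; first exact: bij_comp.
  by rewrite fr.
by rewrite smap_comp /= fa.
Qed.

(* [gh_triple tau] quantifies over all metric spaces, so it is too large to be
   a [choiceType] and [{eq_quot _}] is not available: the classes are taken as
   predicates. *)
Record gh_classes := GHClass {
  gh_class :> gh_triple tau -> Prop;
  gh_classP : exists x, gh_class = gh_equiv x
}.

Definition gh_repr (p : gh_classes) : gh_triple tau := sval (cid (gh_classP p)).

Lemma gh_reprP (p : gh_classes) : gh_class p = gh_equiv (gh_repr p).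
Proof. exact: svalP (cid (gh_classP p)). Qed.

End gh_classes.

Definition thickening (R : realType) (M : metricType R) (A : set M) (e : R) :
    set M :=
  [set x | exists2 y, A y & mdist x y <= e].

Definition hausdorff_dist (R : realType) (M : metricType R) (A B : set M) :
    \bar R :=
  ereal_inf [set e%:E | e in [set e : R |
    [/\ 0 <= e, A `<=` thickening B e & B `<=` thickening A e]]].

Definition fell_dist (R : realType) (M : metricType R)
    (A : set M) (x : M) (B : set M) (y : M) : \bar R :=
  maxe (mdist x y)%:E
    (\int[lebesgue_measure]_(r in `[0%R, +oo[)
       ((expR (- r))%:E *
        mine 1 (hausdorff_dist (A `&` cball x r) (B `&` cball y r))))%E.

Section gh_distances.
Variables (R : realType) (tau : structure R) (d : erm_family tau).

Definition gh_dist_nonpreserved (p q : gh_classes tau) : \bar R :=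
  let x := gh_repr p in let y := gh_repr q in
  ereal_inf [set v : \bar R | exists (Z : bcmType R)
      (f : isoEmb (gh_space x) Z) (g : isoEmb (gh_space y) Z),
    v = maxe
          (fell_dist (range f) (f (gh_root x)) (range g) (g (gh_root y)))
          (d (smap f (gh_elt x), f (gh_root x))
             (smap g (gh_elt y), g (gh_root y)))%:E].

Definition gh_dist_preserved (p q : gh_classes tau) : \bar R :=
  let x := gh_repr p in let y := gh_repr q in
  ereal_inf [set v : \bar R | exists (Z : bcmType R) (z : Z)
      (f : isoEmb (gh_space x) Z) (g : isoEmb (gh_space y) Z),
    [/\ f (gh_root x) = z, g (gh_root y) = z &
        v = maxe
              (fell_dist (range f) z (range g) z)
              (d (smap f (gh_elt x), z) (smap g (gh_elt y), z))%:E]].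

Definition gh_topology_nonpreserved : (gh_classes tau -> Prop) -> Prop :=
  dist_open gh_dist_nonpreserved.

Definition gh_topology_preserved : (gh_classes tau -> Prop) -> Prop :=
  dist_open gh_dist_preserved.

End gh_distances.

(* Main.v *)
(** Non-preserved roots give the smaller distance, so only one inclusion needs
work: if [d(x, y_n) -> 0] without preserving roots, then also with preserved
roots.  Two constructions are combined.

Comparing metrizations: let [X] embed in spaces [Z_n] whose bounded parts
eventually lie near [X].  Gluing all the [Z_n] along [X] gives one boundedly
compact space [W] containing all of them.  On [tau W * W] any two element-rooted
metrizations induce the same topology, and both are invariant under [Z_n -> W],
so convergence to a fixed point of [tau X * X] does not depend on the
metrization.  In particular [d] may be exchanged for a stable one and back.

Matching roots: if [X] and [Y] lie in [Z] with roots at distance at most [e],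
enlarge all cross distances by [e] and cap them by the path through the
identified roots.  The Fell distance grows by at most [e], and a stable
metrization by at most [Theta e]. *)

Require Import Defs.
From HB Require Import structures.
From mathcomp Require Import all_boot all_order all_algebra.
From mathcomp Require Import all_classical all_reals all_analysis.
From mathcomp Require Import measurable_realfun lra.

Set Implicit Arguments.
Unset Strict Implicit.
Unset Printing Implicit Defensive.

Import Order.TTheory GRing.Theory Num.Theory.
Import numFieldTopology.Exports.

Local Open Scope classical_set_scope.
Local Open Scope ring_scope.

(** * Metric spaces from pseudometrics *)

Section metric_quotient.
Context {R : realType} {S : Type} (D : S -> S -> R).

Definition is_pseudometric : Prop :=
  [/\ forall s, D s s = 0, forall s t, D s t = D t s &
      forall t s u, D s u <= D s t + D t u].

Hypothesis D_pm : is_pseudometric.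

Lemma pseudometric0_congr s s' t t' :
  D s s' = 0 -> D t t' = 0 -> D s t = D s' t'.
Proof.
have [D0 Dsym Dtri] := D_pm => ss tt.
have := Dtri s' s t; have := Dtri t' s' t; have := Dtri s s' t'.
have := Dtri t s t'; rewrite ss tt (Dsym s' s) (Dsym t' t) ss tt; lra.
Qed.

(** Classes of the relation [D s t = 0], taken as predicates, so that [S] may be any type. *)
Record mquot := MQuot {
  mquot_class : S -> Prop;
  mquot_classP : exists s, mquot_class = fun t => D s t = 0
}.

Definition mquot_repr (p : mquot) : S := sval (cid (mquot_classP p)).

Definition mquot_pi (s : S) : mquot :=
  MQuot (ex_intro (fun s' => (fun t => D s t = 0) = (fun t => D s' t = 0)) s erefl).

Lemma mquot_ext p q : mquot_class p = mquot_class q -> p = q.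
Proof.
case: p q => [p pP] [q qP] /= pq; move: pP; rewrite pq => pP.
by congr MQuot; exact: Prop_irrelevance.
Qed.

Lemma mquot_reprP p : mquot_class p = fun t => D (mquot_repr p) t = 0.
Proof. exact: svalP (cid (mquot_classP p)). Qed.

Lemma mquot_reprK p : mquot_pi (mquot_repr p) = p.
Proof. by apply: mquot_ext; rewrite [RHS]mquot_reprP. Qed.

Lemma mquot_piK s : D (mquot_repr (mquot_pi s)) s = 0.
Proof.
have [D0 _ _] := D_pm.
by have := congr1 (fun P => P s) (mquot_reprP (mquot_pi s)) => /= <-.
Qed.

Definition mquot_dist (p q : mquot) : R := D (mquot_repr p) (mquot_repr q).

Lemma mquot_distE s t : mquot_dist (mquot_pi s) (mquot_pi t) = D s t.
Proof. by apply: pseudometric0_congr; exact: mquot_piK. Qed.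

Lemma mquot_is_metric : is_metric mquot_dist.
Proof.
have [D0 Dsym Dtri] := D_pm.
split; rewrite /mquot_dist //.
move=> p q pq; rewrite -(mquot_reprK p) -(mquot_reprK q).
apply: mquot_ext => /=; apply/funext => t; apply/propext.
by rewrite (pseudometric0_congr pq (D0 t)).
Qed.

End metric_quotient.

(* The unused argument [dP] lets the instances below recover the metric. *)
Definition metrized {R : realType} {T : Type} (d : T -> T -> R)
  (dP : is_metric d) : Type := T.

HB.instance Definition _ (R : realType) (T : Type) (d : T -> T -> R)
  (dP : is_metric d) := gen_eqMixin (metrized dP).
HB.instance Definition _ (R : realType) (T : Type) (d : T -> T -> R)
  (dP : is_metric d) := gen_choiceMixin (metrized dP).
HB.instance Definition _ (R : realType) (T : Type) (d : T -> T -> R)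
  (dP : is_metric d) := isMetric.Build R (metrized dP)
    (let: And4 h _ _ _ := dP in h) (let: And4 _ h _ _ := dP in h)
    (let: And4 _ _ h _ := dP in h) (let: And4 _ _ _ h := dP in h).

Lemma metric_quotient (R : realType) (S : Type) (D : S -> S -> R) :
  is_pseudometric D -> exists (M : metricType R) (pi : S -> M),
    (forall s t, mdist (pi s) (pi t) = D s t) /\ forall m, exists s, m = pi s.
Proof.
move=> DP; exists (metrized (mquot_is_metric DP)); exists (@mquot_pi _ _ D).
split=> [s t|m]; first exact: mquot_distE.
by exists (mquot_repr m); rewrite mquot_reprK.
Qed.

(** * Cluster points and compact sets in metric spaces *)

Section metric_compactness.
Context {R : realType}.
Implicit Types X Y M : metricType R.

Lemma mdist_cluster M (F : set_system M) (p : M) :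
  (forall A e, F A -> 0 < e -> exists2 q, A q & mdist p q < e) -> cluster F p.
Proof.
move=> Fp A B FA /nbhs_ballP[e /= e0 eB].
have [q Aq pq] := Fp A e FA e0.
by exists q; split => //; apply: eB; rewrite ballEmdist.
Qed.

Lemma cluster_mdist M (F : set_system M) (p : M) A e :
  cluster F p -> F A -> 0 < e -> exists2 q, A q & mdist p q < e.
Proof.
move=> Fp FA e0; have [q []] := Fp A _ FA (nbhsx_ballx p e e0).
by rewrite ballEmdist /=; exists q.
Qed.

Lemma cball_closed M (p : M) (r : R) : closed (cball p r).
Proof.
move=> q qcl; rewrite /cball /=; apply/ler_addgt0Pl => e e0.
have [z []] := qcl _ (nbhsx_ballx q e e0).
rewrite /cball ballEmdist /= => pz qz.
by have := metric_triangle p z q; rewrite (metric_sym z q); lra.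
Qed.

Lemma isometry_compact X M (h : X -> M) (A : set X) :
  (forall x y, mdist (h x) (h y) = mdist x y) -> compact A -> compact (h @` A).
Proof.
move=> hP; apply: continuous_compact; apply: continuous_subspaceT => x.
apply/metricType_numDomainType.cvgrPdist_lt => e e0; near=> y; rewrite hP.
by near: y; apply/metricType_numDomainType.nbhs_mdistP; exists e.
Unshelve. all: by end_near. Qed.

End metric_compactness.

Lemma isoEmb_ext (R : realType) (X Y : bcmType R) (f g : isoEmb X Y) :
  f =1 g -> f = g.
Proof.
case: f g => [f fP] [g gP] /= /funext fg; move: fP; rewrite fg => fP.
by congr IsoEmb; exact: Prop_irrelevance.
Qed.

(** * Gluing boundedly-compact spaces *)

(** Take a proper filter containing [A]. If all its members meet one fixed [K n], its trace on [K n]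
    clusters. Otherwise every [K n] is missed by some member, so members come as close to [C] as
    desired and a filter on [C] clusters instead. *)
Lemma asymptotically_compact (R : realType) (M : metricType R) (A C : set M)
    (K : nat -> set M) :
  closed A -> compact C -> (forall n, compact (K n)) ->
  (forall e, 0 < e -> exists n, A `<=` K n `|` thickening C e) -> compact A.
Proof.
move=> Acl Cc Kc AKC F PF FA.
suff [p Fp] : cluster F !=set0.
  by exists p; split=> //; apply: Acl => B Bp; exact: Fp.
have [[n FK]|/forallNP nFK] :=
    pselect (exists n, forall B, F B -> B `&` K n !=set0).
  pose G := filter_from F (fun B => B `&` K n).
  have PG : ProperFilter G.
    apply: filter_from_proper => //; apply: filter_from_filter.
      by exists A.
    move=> B1 B2 FB1 FB2; exists (B1 `&` B2); first exact: filterI.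
    by rewrite setIACA setIid.
  have [|p [_ Gp]] := Kc n G PG; first by exists A => // q [].
  exists p; apply: mdist_cluster => B e FB e0.
  have GB : G (B `&` K n) by exists B.
  by have [q [Bq _] pq] := cluster_mdist Gp GB e0; exists q.
(* The shadow of the filter on [C]: for a member [B] and a tolerance [e], the points of [C] at
   distance less than [e] from [B]. A cluster point of these shadows is one of [F]. *)
pose T (i : set M * R) := C `&` [set c | exists2 b, i.1 b & mdist c b < i.2].
pose G := filter_from [set i : set M * R | F i.1 /\ 0 < i.2] T.
have PG : ProperFilter G.
  apply: filter_from_proper.
    apply: filter_from_filter; first by exists (A, 1).
    move=> [B1 e1] [B2 e2] [/= FB1 e10] [/= FB2 e20].
    exists (B1 `&` B2, Num.min e1 e2) => /=.
      by split; [exact: filterI | rewrite lt_min e10].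
    move=> c [Cc' [b [Bb1 Bb2]]]; rewrite /= lt_min => /andP[cb1 cb2].
    by split; split => //; exists b.
  move=> [B e] [/= FB e0].
  have e20 : 0 < e / 2 by rewrite divr_gt0.
  have [n AK] := AKC _ e20.
  have /existsNP[B' /not_implyP[FB' B'K]] := nFK n.
  have [b [[Bb B'b] Ab]] := filter_ex (filterI (filterI FB FB') FA).
  case: (AK _ Ab) => [Kb|[c Cc' bc]]; first by case: B'K; exists b.
  exists c; split => //; exists b => //=; rewrite metric_sym.
  by rewrite (le_lt_trans bc)// ltr_pdivrMr// ltr_pMr// ltr1n.
have [|p [_ Gp]] := Cc G PG.
  by exists (A, 1) => //= c [].
exists p; apply: mdist_cluster => B e FB e0.
have e20 : 0 < e / 2 by rewrite divr_gt0.
have GB : G (T (B, e / 2)) by exists (B, e / 2).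
have [c [_ [b Bb cb]] pc] := cluster_mdist Gp GB e20; exists b => //.
by have := metric_triangle p c b; move: cb => /=; lra.
Qed.

Section cross_space.
Context {R : realType} (X Y : bcmType R) (c : X -> Y -> R).

(** The triangle inequalities of [sum_dist] for triples meeting both spaces. The value [0] is
    allowed: such pairs of points get identified. *)
Definition cross_metric : Prop :=
  [/\ forall x x' y, c x y <= mdist x x' + c x' y,
      forall x y y', c x y <= c x y' + mdist y' y,
      forall x x' y, mdist x x' <= c x y + c x' y &
      forall x y y', mdist y y' <= c x y + c x y'].

Definition sum_dist (u v : X + Y) : R :=
  match u, v with
  | inl x, inl x' => mdist x x'
  | inr y, inr y' => mdist y y'
  | inl x, inr y => c x y
  | inr y, inl x => c x y
  end.

Lemma sum_dist_pseudometric : cross_metric -> is_pseudometric sum_dist.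
Proof.
move=> [cl cr cX cY]; split; first by move=> [x|y]; exact: mdistxx.
  by move=> [x|y] [x'|y'] //=; exact: metric_sym.
move=> [x'|y'] [x|y] [x''|y''] //=; rewrite ?metric_triangle//.
- by rewrite addrC (metric_sym x') cl.
- by rewrite addrC (metric_sym y) cr.
Qed.

(** Take the quotient of [X + Y] by [sum_dist]; a closed ball in it is a closed subset of a union of
    two compact images of balls. The covering clause determines [M] up to isometry, which
    [cross_embedding] exploits. *)
Lemma cross_space : cross_metric ->
  exists (M : bcmType R) (f : isoEmb X M) (g : isoEmb Y M),
    (forall x y, mdist (f x) (g y) = c x y) /\
    forall m, (exists x, m = f x) \/ exists y, m = g y.
Proof.
move=> cP; have sP := sum_dist_pseudometric cP.
have [M [pi [piE pi_surj]]] := metric_quotient sP.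
have cov m : (exists x, m = pi (inl x)) \/ exists y, m = pi (inr y).
  by have [[x|y] ->] := pi_surj m; [left; exists x | right; exists y].
have [x0] := bcm_inhabited X; have [y0] := bcm_inhabited Y.
have Mc (m : M) (r : R) : compact (cball m r).
  pose rX := r + mdist m (pi (inl x0)); pose rY := r + mdist m (pi (inr y0)).
  pose A := (pi \o inl) @` cball x0 rX `|` (pi \o inr) @` cball y0 rY.
  have Ac : compact A.
    by apply: compactU; apply: isometry_compact; try exact: bcm_compact;
      move=> u v /=; rewrite piE.
  apply: subclosed_compact Ac _; first exact: cball_closed.
  move=> p mp; have [[x px]|[y py]] := cov p; [left|right].
    exists x => //=; rewrite /cball /= -[mdist x0 x]/(sum_dist (inl x0) (inl x)).
    rewrite -piE -px; have := metric_triangle (pi (inl x0)) m p.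
    by move: mp; rewrite /cball /= /rX (metric_sym m (pi _)); lra.
  exists y => //=; rewrite /cball /= -[mdist y0 y]/(sum_dist (inr y0) (inr y)).
  rewrite -piE -py; have := metric_triangle (pi (inr y0)) m p.
  by move: mp; rewrite /cball /= /rY (metric_sym m (pi _)); lra.
pose MB := BcmType (inhabits (pi (inl x0))) Mc.
have fP x x' : mdist (pi (inl x) : MB) (pi (inl x')) = mdist x x' by rewrite piE.
have gP y y' : mdist (pi (inr y) : MB) (pi (inr y')) = mdist y y' by rewrite piE.
exists MB, (IsoEmb fP), (IsoEmb gP); split => // x y.
by rewrite piE.
Qed.

End cross_space.

Section gluing.
Context {R : realType} (X : bcmType R) (Z : nat -> bcmType R).
Variable f : forall n, isoEmb X (Z n).

Let S := {n : nat & bcm_sort (Z n)}.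
Implicit Types u v : S.

(** A path between two different pieces has to pass through the common copy of [X]. *)
Definition through_dist (u v : S) : R :=
  inf [set mdist (tagged u) (f _ x) + mdist (f _ x) (tagged v) | x in setT].

Definition glue_dist (u v : S) : R :=
  if tag u == tag v then mdist (tagged u) (tagged_as u v) else through_dist u v.

Lemma glue_dist_same n (z z' : Z n) :
  glue_dist (existT _ n z) (existT _ n z') = mdist z z'.
Proof. by rewrite /glue_dist /= eqxx tagged_asE. Qed.

Lemma glue_dist_diff u v : tag u != tag v -> glue_dist u v = through_dist u v.
Proof. by rewrite /glue_dist => /negbTE ->. Qed.

Lemma through_dist_le (u v : S) (x : X) :
  through_dist u v <= mdist (tagged u) (f _ x) + mdist (f _ x) (tagged v).
Proof.
apply: ge_inf; last by exists x.
by exists 0 => _ [y _ <-]; rewrite addr_ge0// mdist_ge0.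
Qed.

Lemma le_through_dist (u v : S) (l : R) :
  (forall x, l <= mdist (tagged u) (f _ x) + mdist (f _ x) (tagged v)) ->
  l <= through_dist u v.
Proof.
move=> ul; apply: lb_le_inf => [|_ [x _ <-]]; last exact: ul.
have [x] := bcm_inhabited X.
by exists (mdist (tagged u) (f _ x) + mdist (f _ x) (tagged v)); exists x.
Qed.

Lemma through_dist_sym u v : through_dist u v = through_dist v u.
Proof.
suff le_sym u' v' : through_dist u' v' <= through_dist v' u'.
  by apply/eqP; rewrite eq_le !le_sym.
apply: le_through_dist => x; have := through_dist_le u' v' x.
by rewrite addrC metric_sym [X in _ + X]metric_sym.
Qed.

(** Moving from [x] to [x'] costs the same in every piece, so a path may enter and leave [X] at
    different points. The triangle inequality needs this when the middle point is in a piece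
    different from those of both ends. *)
Lemma glue_dist_le (u v : S) (x x' : X) : glue_dist u v <=
  mdist (tagged u) (f _ x) + mdist x x' + mdist (f _ x') (tagged v).
Proof.
case: u v => n z [m w] /=; have [nm|nm] := eqVneq n m.
  subst m; rewrite glue_dist_same.
  have := metric_triangle z (f n x) w.
  by have := metric_triangle (f n x) (f n x') w; rewrite embP; lra.
rewrite glue_dist_diff//; apply: le_trans (through_dist_le _ _ x) _ => /=.
by have := metric_triangle (f m x) (f m x') w; rewrite embP; lra.
Qed.

Lemma glue_dist_pseudometric : is_pseudometric glue_dist.
Proof.
split.
- by move=> [n z]; rewrite glue_dist_same mdistxx.
- move=> [n z] [m w]; have [nm|nm] := eqVneq n m.
    by subst m; rewrite !glue_dist_same metric_sym.
  by rewrite glue_dist_diff// through_dist_sym -glue_dist_diff 1?eq_sym.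
move=> [m w] [n z] [k y]; have [nm|nm] := eqVneq n m.
  subst m; rewrite glue_dist_same; have [nk|nk] := eqVneq n k.
    by subst k; rewrite !glue_dist_same metric_triangle.
  rewrite !glue_dist_diff// -lerBlDl; apply: le_through_dist => x /=.
  have := through_dist_le (existT _ n z) (existT _ k y) x => /=.
  by have := metric_triangle z w (f n x); lra.
rewrite [glue_dist (existT _ n z) (existT _ m w)]glue_dist_diff//.
have [mk|mk] := eqVneq m k.
  subst k; rewrite glue_dist_same.
  rewrite glue_dist_diff// -lerBlDr; apply: le_through_dist => x /=.
  have := through_dist_le (existT _ n z) (existT _ m y) x => /=.
  by have := metric_triangle (f m x) w y; lra.
rewrite [glue_dist (existT _ m w) _]glue_dist_diff//.
rewrite -lerBlDr; apply: le_through_dist => x /=.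
rewrite lerBlDr -lerBlDl; apply: le_through_dist => x' /=.
rewrite lerBlDl; apply: le_trans (glue_dist_le _ _ x x') _ => /=.
by have := metric_triangle (f m x) w (f m x'); rewrite embP; lra.
Qed.

(** Keeps the glued space boundedly compact: infinitely many pieces may reach into a given ball, and
    their extra points could otherwise stay far apart. *)
Definition vanishing_excess (rho : X) : Prop :=
  forall r e, 0 < e -> exists N, forall n, (N <= n)%N ->
    forall z : Z n, mdist (f n rho) z <= r -> exists x, mdist (f n x) z <= e.

(** In a closed ball of [W], the first [N] pieces contribute a compact set and the later ones stay
    close to a ball of [X], so [asymptotically_compact] applies. *)
Lemma gluing (rho : X) : vanishing_excess rho ->
  exists (W : bcmType R) (i : isoEmb X W) (k : forall n, isoEmb (Z n) W),
    forall n x, k n (f n x) = i x.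
Proof.
move=> ve.
have [W [pi [piE pi_surj]]] := metric_quotient glue_dist_pseudometric.
pose k n z := pi (existT _ n z).
have kP n z z' : mdist (k n z) (k n z') = mdist z z'.
  by rewrite piE glue_dist_same.
(* The piece [0] is an arbitrary choice: [ki] shows that every piece carries the same copy of
   [X]. *)
pose i x := k 0%N (f 0%N x).
have iP x x' : mdist (i x) (i x') = mdist x x' by rewrite kP embP.
have ki n x : k n (f n x) = i x.
  apply: mdist_positivity; apply/eqP; rewrite eq_le mdist_ge0 andbT piE.
  by apply: le_trans (glue_dist_le _ _ x x) _; rewrite /= !mdistxx !addr0.
have Wc (p : W) (r : R) : compact (cball p r).
  pose r' := r + mdist p (i rho).
  have in_ball w : cball p r w -> mdist (i rho) w <= r'.
    have := metric_triangle (i rho) p w.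
    by rewrite /cball /= /r' (metric_sym (i rho) p); lra.
  pose K N := \big[setU/set0]_(n < N) (k n @` cball (f n rho) r').
  have Kc N : compact (K N).
    apply: bigsetU_compact => n _.
    by apply: isometry_compact => //; exact: bcm_compact.
  apply: (asymptotically_compact (@cball_closed _ _ p r) _ Kc).
    apply: (isometry_compact iP); exact: (bcm_compact (x := rho) (r := r' + 1)).
  (* Capping at [1] keeps the nearby point of [X] in the ball of radius [r' + 1]. *)
  move=> e e0; have e10 : 0 < Num.min e 1 by rewrite lt_min e0 ltr01.
  have [N HN] := ve r' _ e10; exists N => w pw.
  have [[n z] wE] := pi_surj w; have {}wE : w = k n z by [].
  have rw := in_ball _ pw.
  have rz : mdist (f n rho) z <= r' by rewrite -kP ki -wE.
  have [nN|nN] := ltnP n N.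
    left; rewrite /K -(bigcup_mkord N (fun n => k n @` cball (f n rho) r')).
    by exists n => //; exists z.
  right; have [x] := HN n nN z rz; rewrite le_min => /andP[xe x1].
  have wx : mdist w (i x) = mdist (f n x) z by rewrite wE -(ki n) kP metric_sym.
  exists (i x); last by rewrite wx.
  exists x => //; rewrite /cball /= -iP.
  by have := metric_triangle (i rho) w (i x); rewrite wx; lra.
have [x0] := bcm_inhabited X.
pose WB := BcmType (inhabits (i x0)) Wc.
by exists WB, (@IsoEmb _ X WB i iP), (fun n => @IsoEmb _ (Z n) WB (k n) (kP n)).
Qed.

End gluing.

(** * Comparison of element-rooted metrizations *)

Lemma metrizes_transfer (R : realType) (T : topologicalType) (d d' : T -> T -> R)
    (p : T) (e : R) :
  metrizes d -> metrizes d' -> 0 < e ->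
  exists2 delta, 0 < delta & forall q, d p q < delta -> d' p q < e.
Proof.
move=> [_ dE] [[d0 _ _ dtri] d'E] e0.
pose U := [set q | d' p q < e].
have : dist_open (fun x y => (d x y)%:E) U.
  rewrite -dE d'E => q Uq; exists (e - d' p q); first by rewrite subr_gt0.
  move=> r; rewrite lte_fin /U /= => qr.
  by rewrite (le_lt_trans (dtri q _ _))// -ltrBrDl.
case/(_ p); first by rewrite /U /= d0.
by move=> delta delta0 pU; exists delta => // q pq; apply: pU; rewrite lte_fin.
Qed.

Section erm.
Context {R : realType} {tau : structure R}.
Implicit Types d : erm_family tau.

(** In the glued space [W] the points [(smap (f n) p.1, f n p.2)] all become one, by functoriality;
    there [metrizes_transfer] yields a single [delta] for all [n]. *)
Lemma erm_transfer d d' (X : bcmType R) (Z : nat -> bcmType R)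
    (f : forall n, isoEmb X (Z n)) (rho : X) (p : (tau X * X)%type)
    (q : forall n, (tau (Z n) * Z n)%type) :
  is_erm d -> is_erm d' -> vanishing_excess f rho ->
  (forall e, 0 < e -> exists N, forall n, (N <= n)%N ->
     d (Z n) (smap (f n) p.1, f n p.2) (q n) < e) ->
  forall e, 0 < e -> exists N, forall n, (N <= n)%N ->
     d' (Z n) (smap (f n) p.1, f n p.2) (q n) < e.
Proof.
move=> [dM dE] [d'M d'E] /gluing[W [i [k ki]]] dq e e0.
have ski n : smap i p.1 = smap (k n) (smap (f n) p.1).
  rewrite -[RHS]/((smap (k n) \o smap (f n)) p.1) -smap_comp.
  by congr (smap _ _); apply: isoEmb_ext => x /=; rewrite ki.
have [delta delta0 dd'] :=
  metrizes_transfer (smap i p.1, i p.2) (dM W) (d'M W) e0.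
have [N HN] := dq _ delta0; exists N => n nN.
rewrite [q n]surjective_pairing -(d'E _ _ (k n)) ki -ski; apply: dd'.
rewrite -(ki n) (ski n) dE -surjective_pairing; exact: HN.
Qed.

(** Sending [f1 x] to [f2 x] and [g1 y] to [g2 y] is well defined: two descriptions of one point of
    [M] are at distance [0], and so are their prospective images. *)
Lemma cross_embedding (X Y M Z : bcmType R) (f1 : isoEmb X M) (g1 : isoEmb Y M)
    (f2 : isoEmb X Z) (g2 : isoEmb Y Z) :
  (forall m, (exists x, m = f1 x) \/ exists y, m = g1 y) ->
  (forall x y, mdist (f1 x) (g1 y) = mdist (f2 x) (g2 y)) ->
  exists h : isoEmb M Z, emb_comp h f1 = f2 /\ emb_comp h g1 = g2.
Proof.
move=> cov c12.
have eq0 (N : bcmType R) (u v : N) : mdist u v = 0 <-> u = v.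
  by split=> [|->]; [exact: mdist_positivity | exact: mdistxx].
have /choice[h hP] (m : M) : exists z, (forall x, m = f1 x -> z = f2 x) /\
    forall y, m = g1 y -> z = g2 y.
  have [[x ->]|[y ->]] := cov m.
    exists (f2 x); split=> [x' /eq0|y /eq0].
      by rewrite embP => /eq0 ->.
    by rewrite c12 => /eq0.
  exists (g2 y); split=> [x /esym/eq0|y' /eq0].
    by rewrite c12 => /eq0.
  by rewrite embP => /eq0 ->.
have hf x : h (f1 x) = f2 x by exact: (hP _).1.
have hg y : h (g1 y) = g2 y by exact: (hP _).2.
have hE m m' : mdist (h m) (h m') = mdist m m'.
  have [[x ->]|[y ->]] := cov m; have [[x' ->]|[y' ->]] := cov m';
    rewrite ?hf ?hg ?embP ?c12//.
  by rewrite metric_sym -c12 metric_sym.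
by exists (IsoEmb hE); split; apply: isoEmb_ext => x /=; rewrite ?hf ?hg.
Qed.

(** [M] embeds into [Z] compatibly with [X] and [Y], so the value of [d] depends on the cross
    distances and not on the rest of the ambient space. *)
Lemma erm_cross d (X Y M Z : bcmType R) (f1 : isoEmb X M) (g1 : isoEmb Y M)
    (f2 : isoEmb X Z) (g2 : isoEmb Y Z) (a : tau X) (x : X) (b : tau Y) (y : Y) :
  is_erm d -> (forall m, (exists x, m = f1 x) \/ exists y, m = g1 y) ->
  (forall x y, mdist (f1 x) (g1 y) = mdist (f2 x) (g2 y)) ->
  d M (smap f1 a, f1 x) (smap g1 b, g1 y) =
  d Z (smap f2 a, f2 x) (smap g2 b, g2 y).
Proof.
move=> [_ dE] cov /(cross_embedding cov)[h [<- <-]].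
by rewrite !smap_comp /= dE.
Qed.

End erm.

(** * Estimates for the Fell distance *)

Import HBNNSimple.

Section lower_integral.
Local Open Scope ereal_scope.
Context d (T : measurableType d) (R : realType).
Variable mu : {measure set T -> \bar R}.
Implicit Types (D : set T) (f g : T -> \bar R).

(* The integrand of [fell_dist] is not known to be measurable.  As the library
   integrates nonnegative functions by their lower integral, [ge0_le_integral]
   and the relevant half of [ge0_integralD] survive without that assumption. *)
Lemma le_lower_integral D f g : (forall x, D x -> 0 <= f x) ->
  (forall x, D x -> f x <= g x) ->
  \int[mu]_(x in D) f x <= \int[mu]_(x in D) g x.
Proof.
move=> f0 fg; have g0 x : D x -> 0 <= g x.
  by move=> Dx; rewrite (le_trans (f0 x Dx)) ?fg.
rewrite !ge0_integralE//; apply: ge_ereal_sup => _ [h hf <-].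
apply: ereal_sup_ubound; exists h => // x /=; apply: le_trans (hf x) _.
by rewrite !patchE; case: ifPn => // /set_mem; exact: fg.
Qed.

Lemma lower_integralD D f (g : T -> R) : measurable D ->
  (forall x, D x -> 0 <= f x) -> (forall x, D x -> (0 <= g x)%R) ->
  measurable_fun D g ->
  \int[mu]_(x in D) (f x + (g x)%:E) <=
    \int[mu]_(x in D) f x + \int[mu]_(x in D) (g x)%:E.
Proof.
move=> mD f0 g0 mg.
rewrite [leLHS]ge0_integralE; last first.
  by move=> x Dx; rewrite adde_ge0 ?f0// lee_fin g0.
apply: ge_ereal_sup => _ [h /= hfg <-].
have hD : h \_ D = h.
  apply/funext => x; rewrite patchE; case: ifPn => // xD.
  apply/esym/eqP; rewrite eq_le fun_ge0 andbT -lee_fin.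
  by apply: le_trans (hfg x) _; rewrite patchE (negbTE xD).
rewrite -hD -integral_nnsfun//.
have mh : measurable_fun D h by exact: measurable_funTS.
(* The share of the simple function [h] left for [f]: it is measurable, satisfies [h <= k + g], and
   on [D] is at most [f] because [f] is nonnegative there. *)
pose k x := Num.max (h x - g x)%R 0%R.
have mk : measurable_fun D k by apply: measurable_maxr => //; exact: measurable_funB.
have k0 x : (0 <= k x)%R by rewrite /k le_max lexx orbT.
apply: (@le_trans _ _ (\int[mu]_(x in D) ((k x)%:E + (g x)%:E))).
  apply: le_lower_integral => x Dx; first by rewrite lee_fin fun_ge0.
  by rewrite -EFinD lee_fin -lerBlDr le_max lexx.
rewrite ge0_integralD//; last 3 first.
- by move=> x _; rewrite lee_fin k0.
- exact/measurable_EFinP.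
- exact/measurable_EFinP.
rewrite leeD2r//; apply: le_lower_integral => x Dx; first by rewrite lee_fin.
rewrite /k EFin_max ge_max f0// andbT EFinB leeBlDr//.
by apply: le_trans (hfg x) _; rewrite patchE mem_set.
Qed.

End lower_integral.

Lemma integral_expRN_le1 (R : realType) :
  (\int[lebesgue_measure]_(r in `[0%R, +oo[) (expR (- r : R))%:E <= 1)%E.
Proof.
rewrite -(@integral_exponential_pdf R 1)// [leLHS]integral_mkcond.
apply: le_lower_integral => x _; rewrite patchE; case: ifPn => x0 //.
- by rewrite /exponential_pdf patchE x0 mul1r mulN1r.
- by rewrite lee_fin /exponential_pdf patchE (negbTE x0).
Qed.

Section fell_estimates.
Context {R : realType}.

Lemma hausdorff_dist_ge0 (M : metricType R) (A B : set M) :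
  (0 <= hausdorff_dist A B)%E.
Proof. by apply: le_ereal_inf_tmp => _ [e [e0 _ _] <-]; rewrite lee_fin. Qed.

Lemma fell_integrand_ge0 (M : metricType R) (A B : set M) (r : R) :
  (0 <= (expR (- r))%:E * mine 1 (hausdorff_dist A B))%E.
Proof.
by rewrite mule_ge0// ?lee_fin ?expR_ge0// le_min lee01 hausdorff_dist_ge0.
Qed.

Lemma hausdorff_dist_lt (M : metricType R) (A B : set M) (e : R) :
  (hausdorff_dist A B < e%:E)%E -> B `<=` thickening A e.
Proof.
move=> /ereal_inf_lt[_ [e' [_ _ BA] <-]]; rewrite lte_fin => e'e y /BA[x Ax xy].
by exists x => //; rewrite (le_trans xy)// ltW.
Qed.

(** If the Hausdorff distance were at least [e] at every radius [s >= r], the interval [[r, r + 1]]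
    alone would contribute [e * expR (- (r + 1))] to the integral. The bound [e <= 1] makes the
    truncation at [1] harmless. *)
Lemma fell_dist_lt (M : metricType R) (A B : set M) (x y : M) (r e : R) :
  0 <= r -> 0 < e -> e <= 1 ->
  (fell_dist A x B y < (e * expR (- (r + 1)))%:E)%E ->
  exists2 s, r <= s & (hausdorff_dist (A `&` cball x s) (B `&` cball y s) < e%:E)%E.
Proof.
move=> r0 e0 e1; rewrite /fell_dist gt_max => /andP[_].
apply: contraPP => /forall2NP noS; apply/negP; rewrite -leNgt.
have {}noS s : r <= s ->
    (e%:E <= hausdorff_dist (A `&` cball x s) (B `&` cball y s))%E.
  by move=> rs; have [//|/negP] := noS s; rewrite -leNgt.
have Ir : `[r, r + 1] `<=` (`[0, +oo[ : set R).
  by move=> s /=; rewrite !in_itv /= andbT => /andP[rs _]; rewrite (le_trans r0).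
apply: (@le_trans _ _ (\int[lebesgue_measure]_(s in `[r, (r + 1)%R])
    (e * expR (- (r + 1)))%:E)%E).
  rewrite integral_cst//= lebesgue_measure_itv /= lte_fin ltrDl ltr01.
  by rewrite -EFinD addrAC subrr add0r mule1.
rewrite integral_mkcond [leRHS]integral_mkcond.
apply: le_lower_integral => s _.
  rewrite patchE; case: ifPn => // _.
  by rewrite lee_fin mulr_ge0// ?expR_ge0// ltW.
rewrite !patchE; case: ifPn => [/set_mem sr|_]; last first.
  by case: ifPn => // _; exact: fell_integrand_ge0.
rewrite mem_set; last exact: Ir.
move: sr; rewrite /= in_itv /= => /andP[rs sr].
rewrite mulrC EFinM; apply: lee_pmul; rewrite ?lee_fin ?expR_ge0// ?(ltW e0)//.
  by rewrite ler_expR lerN2.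
by rewrite le_min lee_fin e1 noS.
Qed.

Variables (X Y Z M : bcmType R).
Variables (f : isoEmb X Z) (g : isoEmb Y Z) (f' : isoEmb X M) (g' : isoEmb Y M).
Variables (e : R) (e0 : 0 <= e).
Hypothesis fg' : forall x y, mdist (f' x) (g' y) <= mdist (f x) (g y) + e.

(** The ball around the image of [x] cuts out the same points of [X] in both ambient spaces, and
    likewise for [y] and [Y]; so an admissible [h] for the old distance gives [h + e] for the new
    one. *)
Lemma hausdorff_dist_shift x y r :
  (hausdorff_dist (range f' `&` cball (f' x) r) (range g' `&` cball (g' y) r) <=
   hausdorff_dist (range f `&` cball (f x) r) (range g `&` cball (g y) r) + e%:E)%E.
Proof.
rewrite -leeBlDr//; apply: le_ereal_inf_tmp => _ [h [h0 AB BA] <-].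
rewrite leeBlDr//; apply: ereal_inf_lbound; exists (h + e) => //; split.
- by rewrite addr_ge0.
- move=> _ [[u _ <-]]; rewrite /cball /= embP => xu.
  have [|_ [[v _ <-] yv] uv] := AB (f u).
    by split; [exists u | rewrite /cball /= embP].
  exists (g' v); last by apply: le_trans (fg' u v) _; rewrite lerD2r.
  by split; [exists v | move: yv; rewrite /cball /= !embP].
- move=> _ [[v _ <-]]; rewrite /cball /= embP => yv.
  have [|_ [[u _ <-] xu] uv] := BA (g v).
    by split; [exists v | rewrite /cball /= embP].
  exists (f' u); last first.
    rewrite metric_sym; apply: le_trans (fg' u v) _.
    by rewrite lerD2r metric_sym.
  by split; [exists u | move: xu; rewrite /cball /= !embP].
Qed.

(** The roots coincide in [M], so only the integral matters; it grows by at most the integral of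
    [expR (- r) * e], hence by at most [e]. *)
Lemma fell_dist_shift x y : f' x = g' y ->
  (fell_dist (range f') (f' x) (range g') (g' y) <=
   fell_dist (range f) (f x) (range g) (g y) + e%:E)%E.
Proof.
move=> xy; rewrite {1}/fell_dist ge_max; apply/andP; split.
  rewrite xy mdistxx adde_ge0 ?lee_fin// /fell_dist le_max.
  by rewrite lee_fin mdist_ge0.
pose F r := ((expR (- r))%:E * mine 1 (hausdorff_dist
  (range f `&` cball (f x) r) (range g `&` cball (g y) r)))%E.
pose G r := expR (- r) * e.
apply: (@le_trans _ _
    (\int[lebesgue_measure]_(r in `[0%R, +oo[) (F r + (G r)%:E))%E).
  apply: le_lower_integral => r _; first exact: fell_integrand_ge0.
  rewrite /F /G EFinM -ge0_muleDr ?lee_fin//; last first.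
    by rewrite le_min lee01 hausdorff_dist_ge0.
  apply: lee_wpmul2l; first by rewrite lee_fin expR_ge0.
  have := hausdorff_dist_shift x y r.
  set h := hausdorff_dist (range f `&` _) _ => h'h.
  case: (leP 1%E h) => _; first by rewrite ge_min leeDl ?lee_fin.
  by rewrite ge_min h'h orbT.
have me : measurable_fun (`[0%R, +oo[ : set R) (fun r : R => expR (- r)).
  by apply: measurable_funTS; apply: measurableT_comp.
apply: le_trans (lower_integralD _ _ _ _ _) _ => //.
- by move=> r _; exact: fell_integrand_ge0.
- by move=> r _; rewrite mulr_ge0// expR_ge0.
- exact: measurable_funM.
apply: leeD; first by rewrite /fell_dist le_max lexx orbT.
under eq_integral do rewrite /G mulrC EFinM.
rewrite ge0_integralZl//; last exact/measurable_EFinP.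
by rewrite -[leRHS]mule1 lee_wpmul2l ?lee_fin// integral_expRN_le1.
Qed.

End fell_estimates.

(** * Identifying the roots *)

Lemma cross_metric_embeddings (R : realType) (X Y Z : bcmType R)
    (f : isoEmb X Z) (g : isoEmb Y Z) :
  cross_metric (fun x y => mdist (f x) (g y)).
Proof.
split=> [x x' y|x y y'|x x' y|x y y'].
- by rewrite -(embP f) metric_triangle.
- by rewrite -(embP g) metric_triangle.
- by rewrite -(embP f) [X in _ + X]metric_sym metric_triangle.
- by rewrite -(embP g) [X in X + _]metric_sym metric_triangle.
Qed.

Section inverse_successor.
Context {R : realType}.

Definition invS (n : nat) : R := n.+1%:R^-1.

Lemma invS_gt0 n : 0 < invS n.
Proof. by rewrite /invS invr_gt0. Qed.

Lemma invS_le1 n : invS n <= 1.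
Proof. by rewrite /invS invf_le1// ler1n. Qed.

Lemma invS_lt (e : R) : 0 < e -> exists N, forall n, (N <= n)%N -> invS n < e.
Proof.
move=> e0; have [N _ HN] := near_infty_natSinv_lt (PosNum e0).
by exists N => n /HN.
Qed.

End inverse_successor.

Section wedge.
Context {R : realType} {X Y : bcmType R} (c : X -> Y -> R).
Context (rho : X) (sigma : Y) (e : R).

(* The cross distance after the roots have been identified. *)
Definition wedge (x : X) (y : Y) : R :=
  Num.min (c x y + e) (mdist x rho + mdist sigma y).

Hypothesis cP : cross_metric c.
Hypothesis ce : c rho sigma <= e.

Lemma cross_metric_ge0 x y : 0 <= c x y.
Proof. by have [_ _ cX _] := cP; have := cX x x y; rewrite mdistxx; lra. Qed.

Lemma wedge_roots : wedge rho sigma = 0.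
Proof.
rewrite /wedge !mdistxx addr0 min_r// addr_ge0 ?cross_metric_ge0//.
by rewrite (le_trans _ ce) ?cross_metric_ge0.
Qed.

Lemma wedge_le x y : wedge x y <= c x y + e.
Proof. by rewrite ge_min lexx. Qed.

Lemma wedge_root_ge y : c rho y <= wedge rho y + e.
Proof.
have [_ cr _ _] := cP; have := cr rho y sigma; have := cross_metric_ge0 rho sigma.
by have := ce; rewrite /wedge mdistxx; case: (leP (c rho y + e)); lra.
Qed.

(** The last two inequalities are delicate when one leg is direct and the other goes through the
    roots: exchanging [sigma] and [rho] costs [c rho sigma], which the [e] added to the direct leg
    pays for. *)
Lemma wedge_cross_metric : cross_metric wedge.
Proof.
have [cl cr cX cY] := cP; have c0 := cross_metric_ge0; have e_ge := ce.
have X0 (x x' : X) : 0 <= mdist x x' := mdist_ge0 x x'.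
have Y0 (y y' : Y) : 0 <= mdist y y' := mdist_ge0 y y'.
split=> [x x' y|x y y'|x x' y|x y y']; rewrite /wedge.
- have := cl x x' y; have := metric_triangle x x' rho.
  case: (leP (c x y + e)); case: (leP (c x' y + e)); lra.
- have := cr x y y'; have := metric_triangle sigma y' y.
  case: (leP (c x y + e)); case: (leP (c x y' + e)); lra.
- have := cX x x' y; have := metric_triangle x rho x'.
  have := cX x rho y; have := cX rho x' y; have := cr rho y sigma.
  have := cr rho sigma y; have := cr x sigma y; have := cr x' sigma y.
  have := cX x rho sigma; have := cX x' rho sigma.
  have := metric_sym rho x'; have := metric_sym sigma y.
  have := c0 x y; have := c0 x' y; have := c0 rho sigma; have := Y0 sigma y.
  have := metric_sym x x'; have := metric_sym x' rho.
  case: (leP (c x y + e)); case: (leP (c x' y + e)); lra.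
- have := cY x y y'; have := metric_triangle y sigma y'.
  have := cl rho x y; have := cl rho x y'.
  have := cY rho sigma y; have := cY rho sigma y'.
  have := metric_sym rho x; have := metric_sym sigma y.
  have := c0 x y; have := c0 x y'; have := c0 rho sigma; have := X0 x rho.
  case: (leP (c x y + e)); case: (leP (c x y' + e)); lra.
Qed.

End wedge.

(** * Excess along a sequence of spaces, and the matching of roots *)

Section root_matching.
Context {R : realType} {X : bcmType R} {Y : nat -> bcmType R}.

(** [vanishing_excess] in terms of cross distances alone, so that it can be checked before an
    ambient space is chosen. *)
Definition cross_excess (c : forall n, X -> Y n -> R) (rho : X) : Prop :=
  forall r e, 0 < e -> exists N, forall n, (N <= n)%N ->
    forall y : Y n, c n rho y <= r -> exists x, c n x y <= e.

Lemma cross_excess_vanishing (c : forall n, X -> Y n -> R) (rho : X)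
    (M : nat -> bcmType R) (f : forall n, isoEmb X (M n))
    (g : forall n, isoEmb (Y n) (M n)) :
  cross_excess c rho -> (forall n x y, mdist (f n x) (g n y) = c n x y) ->
  (forall n m, (exists x, m = f n x) \/ exists y, m = g n y) ->
  vanishing_excess f rho.
Proof.
move=> cE fg cov r e e0; have [N HN] := cE r e e0; exists N => n nN m.
have [[x ->] _|[y ->]] := cov n m; first by exists x; rewrite mdistxx ltW.
by rewrite fg => /(HN n nN)[x xy]; exists x; rewrite fg.
Qed.

Context (rho : X) (sigma : forall n, Y n).

Lemma fell_dist_cross_excess (Z : nat -> bcmType R)
    (f : forall n, isoEmb X (Z n)) (g : forall n, isoEmb (Y n) (Z n)) :
  (forall n, fell_dist (range (f n)) (f n rho) (range (g n)) (g n (sigma n))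
     < (invS n)%:E)%E ->
  cross_excess (fun n x y => mdist (f n x) (g n y)) rho.
Proof.
move=> fell_small r e e0.
(* [fell_dist_lt] asks for a tolerance at most [1] and a nonnegative radius. The extra [1] in [r']
   absorbs the distance between the roots, as the balls in [Y n] are centred at [sigma n]. *)
pose e' := Num.min e 1; pose r' := Num.max r 0 + 1.
have e'0 : 0 < e' by rewrite lt_min e0 ltr01.
have e'1 : e' <= 1 by rewrite ge_min lexx orbT.
have r'0 : 0 <= r' by rewrite addr_ge0// le_max lexx orbT.
have rr' : r + 1 <= r' by rewrite lerD2r le_max lexx.
have [N HN] := invS_lt (mulr_gt0 e'0 (expR_gt0 (- (r' + 1)))).
exists N => n nN y ry.
have [|s r's /hausdorff_dist_lt sub] := fell_dist_lt
  (A := range (f n)) (B := range (g n)) (x := f n rho) (y := g n (sigma n))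
  r'0 e'0 e'1.
  by apply: lt_trans (fell_small n) _; rewrite lte_fin HN.
have roots : mdist (f n rho) (g n (sigma n)) < invS n.
  rewrite -lte_fin; apply: le_lt_trans (fell_small n).
  by rewrite /fell_dist le_max lexx.
have [|_ [[x _ <-] _] yx] := sub (g n y).
  split; first by exists y.
  rewrite /cball /=; have := metric_triangle (g n (sigma n)) (f n rho) (g n y).
  have n1 := @invS_le1 R n.
  by rewrite (metric_sym (g n (sigma n)) (f n rho)); lra.
by exists x; rewrite metric_sym (le_trans yx)// ge_min lexx.
Qed.

Lemma wedge_cross_excess (c : forall n, X -> Y n -> R) :
  (forall n, cross_metric (c n)) ->
  (forall n, c n rho (sigma n) <= invS n) -> cross_excess c rho ->
  cross_excess (fun n => wedge (c n) rho (sigma n) (invS n)) rho.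
Proof.
move=> cP ce cE r e e0; have e20 : 0 < e / 2 by rewrite divr_gt0.
(* By [wedge_root_ge] the old distance exceeds the new one by at most [invS n <= 1]. Half of [e] is
   for the old excess, half for the [invS n] that [wedge] adds. *)
have [N1 HN1] := cE (r + 1) _ e20; have [N2 HN2] := invS_lt e20.
exists (maxn N1 N2) => n; rewrite geq_max => /andP[nN1 nN2] y ry.
have [|x xy] := HN1 n nN1 y.
  by have := wedge_root_ge (cP n) (ce n) y; have n1 := @invS_le1 R n; lra.
exists x; apply: le_trans (wedge_le _ _ _ _ _ _) _.
by have := HN2 n nN2; lra.
Qed.

End root_matching.

Lemma cross_spaces (R : realType) (X : bcmType R) (Y : nat -> bcmType R)
    (c : forall n, X -> Y n -> R) : (forall n, cross_metric (c n)) ->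
  exists (M : nat -> bcmType R) (f : forall n, isoEmb X (M n))
    (g : forall n, isoEmb (Y n) (M n)),
    (forall n x y, mdist (f n x) (g n y) = c n x y) /\
    forall n m, (exists x, m = f n x) \/ exists y, m = g n y.
Proof.
move=> cP.
have F n : {M : bcmType R & {f : isoEmb X M & {g : isoEmb (Y n) M |
    (forall x y, mdist (f x) (g y) = c n x y) /\
    forall m, (exists x, m = f x) \/ exists y, m = g y}}}.
  by have /cid[M /cid[f /cid[g fg]]] := cross_space (cP n); exists M, f, g.
exists (fun n => projT1 (F n)), (fun n => projT1 (projT2 (F n))),
  (fun n => sval (projT2 (projT2 (F n)))).
by split=> n; have [] := svalP (projT2 (projT2 (F n))).
Qed.

(** Smallness travels from [d] on [Z n] to [d] on [U n] by [erm_cross], to [ds] on [U n] by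
    [erm_transfer], to [ds] on [M n] by stability, and to [d] on [M n] by [erm_transfer] again. *)
Lemma root_matching (R : realType) (tau : structure R) (d : erm_family tau)
    (X : bcmType R) (rho : X) (a : tau X) (Y : nat -> bcmType R)
    (sigma : forall n, Y n) (b : forall n, tau (Y n)) (Z : nat -> bcmType R)
    (f : forall n, isoEmb X (Z n)) (g : forall n, isoEmb (Y n) (Z n)) (e : R) :
  is_erm d -> stably_metrizable tau ->
  (forall n, fell_dist (range (f n)) (f n rho) (range (g n)) (g n (sigma n))
     < (invS n)%:E)%E ->
  (forall n, d (Z n) (smap (f n) a, f n rho) (smap (g n) (b n), g n (sigma n))
     < invS n) ->
  0 < e ->
  exists n (M : bcmType R) (f' : isoEmb X M) (g' : isoEmb (Y n) M),
    [/\ f' rho = g' (sigma n),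
        (fell_dist (range f') (f' rho) (range g') (g' (sigma n)) < e%:E)%E &
        d M (smap f' a, f' rho) (smap g' (b n), g' (sigma n)) < e].
Proof.
move=> d_erm [ds [ds_erm [Th [_ Th_cvg _ ds_stable]]]].
move=> fell_small d_small e0.
pose c n x y := mdist (f n x) (g n y).
have cP n : cross_metric (c n) := cross_metric_embeddings (f n) (g n).
have ce n : c n rho (sigma n) <= invS n.
  rewrite -lee_fin; apply: le_trans (ltW (fell_small n)).
  by rewrite /fell_dist le_max lexx.
have cE : cross_excess c rho := fell_dist_cross_excess fell_small.
(* [U n] is a copy of the part of [Z n] covered by [X] and [Y n]. The rest of [Z n] is not
   controlled by the Fell distance and could violate [vanishing_excess]. *)
have [U [fU [gU [cU covU]]]] := cross_spaces cP.
have excU : vanishing_excess fU rho := cross_excess_vanishing cE cU covU.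
have dsU : forall e, 0 < e -> exists N, forall n, (N <= n)%N ->
    ds (U n) (smap (fU n) a, fU n rho) (smap (gU n) (b n), gU n (sigma n)) < e.
  apply: (erm_transfer (p := (a, rho)) d_erm ds_erm excU) => t t0.
  have [N HN] := invS_lt t0; exists N => n nN /=.
  rewrite (erm_cross _ _ _ _ d_erm (covU n) (cU n)).
  exact: lt_trans (d_small n) (HN n nN).
pose c' n := wedge (c n) rho (sigma n) (invS n).
have c'P n : cross_metric (c' n) := wedge_cross_metric (cP n) (ce n).
have c'E : cross_excess c' rho := wedge_cross_excess cP ce cE.
have [M [fM [gM [cM covM]]]] := cross_spaces c'P.
have excM : vanishing_excess fM rho := cross_excess_vanishing c'E cM covM.
have c'c n x y : mdist (fM n x) (gM n y) <= c n x y + invS n.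
  by rewrite cM wedge_le.
have dsM : forall e, 0 < e -> exists N, forall n, (N <= n)%N ->
    ds (M n) (smap (fM n) a, fM n rho) (smap (gM n) (b n), gM n (sigma n)) < e.
  move=> t t0; have t20 : 0 < t / 2 by rewrite divr_gt0.
  have [N1 HN1] := dsU _ t20.
  (* The limit of [Th] is one-sided, hence the condition [0 < s], which [invS n] meets. *)
  have [delta delta0 Th_lt] : exists2 delta, 0 < delta &
      forall s, 0 < s -> s < delta -> Th s < t / 2.
    move/cvgrPdist_lt : Th_cvg => /(_ _ t20)[delta /= delta0 H].
    exists delta => // s s0 sdelta; have := H s.
    rewrite /= !sub0r !normrN gtr0_norm// => /(_ sdelta s0).
    exact: le_lt_trans (ler_norm _).
  have [N2 HN2] := invS_lt delta0.
  exists (maxn N1 N2) => n; rewrite geq_max => /andP[nN1 nN2].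
  apply: le_lt_trans (ds_stable _ _ _ _ (fU n) (gU n) (fM n) (gM n) _
    (ltW (invS_gt0 n)) _ a rho (b n) (sigma n)) _.
    by move=> x y; rewrite cU.
  have := HN1 n nN1; have := Th_lt _ (invS_gt0 n) (HN2 n nN2); lra.
have dM := erm_transfer (p := (a, rho)) ds_erm d_erm excM dsM.
have [N1 HN1] := dM _ e0; have e20 : 0 < e / 2 by rewrite divr_gt0.
have [N2 HN2] := invS_lt e20; pose n := maxn N1 N2.
have roots : fM n rho = gM n (sigma n).
  by apply: mdist_positivity; rewrite cM /c' wedge_roots.
exists n, (M n), (fM n), (gM n); split => //; last exact/HN1/leq_maxl.
apply: le_lt_trans (fell_dist_shift (ltW (invS_gt0 n)) (c'c n) roots) _.
have n2 : invS n < e / 2 by exact/HN2/leq_maxr.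
apply: (@lt_le_trans _ _ ((invS n)%:E + (invS n)%:E)%E).
  by rewrite lteD2rE.
by rewrite -EFinD lee_fin; lra.
Qed.

Theorem corollary6p31 (R : realType) (tau : structure R)
    (tau_cont : embedding_continuous tau)
    (tau_stable : stably_metrizable tau)
    (d : erm_family tau) (d_erm : is_erm d) :
  gh_topology_preserved d = gh_topology_nonpreserved d.
Proof.
apply/funext => V; apply/propext; split=> openV p Vp; last first.
  (* Root-preserving pairs of embeddings are among those of the other infimum. *)
  have [e e0 pV] := openV p Vp; exists e => // q pq; apply: pV.
  apply: le_lt_trans pq; apply: le_ereal_inf => _ [Z [z [f [g [fz gz ->]]]]].
  by exists Z, f, g; rewrite fz gz.
have [e e0 pV] := openV p Vp.
(* If no ball works, there are [q n] outside [V] at non-preserved distance below [invS n] from [p].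
   Matching roots brings some [q n] within preserved distance [e] of [p], hence into [V]. *)
apply: contrapT => noball.
pose np_bound n (q : gh_triple tau) (Z : bcmType R)
    (f : isoEmb (gh_space (gh_repr p)) Z) (g : isoEmb (gh_space q) Z) :=
  (fell_dist (range f) (f (gh_root (gh_repr p))) (range g) (g (gh_root q))
     < (invS n)%:E)%E /\
  d Z (smap f (gh_elt (gh_repr p)), f (gh_root (gh_repr p)))
      (smap g (gh_elt q), g (gh_root q)) < invS n.
have F n : {q : gh_classes tau & {Z : bcmType R &
    {f : isoEmb (gh_space (gh_repr p)) Z &
    {g : isoEmb (gh_space (gh_repr q)) Z | ~ V q /\ np_bound n _ Z f g}}}}.
  have : ~ forall q, (gh_dist_nonpreserved d p q < (invS n)%:E)%E -> V q.
    by move=> H; apply: noball; exists (invS n) => //; exact: invS_gt0.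
  move=> /existsNP/cid[q /not_implyP[/ereal_inf_lt/cid2[v]]].
  move=> /cid[Z /cid[f /cid[g ->]]]; rewrite gt_max lte_fin => /andP[fell_lt d_lt] nVq.
  by exists q, Z, f, g.
pose q n := projT1 (F n).
pose Z n := projT1 (projT2 (F n)).
pose f n : isoEmb (gh_space (gh_repr p)) (Z n) := projT1 (projT2 (projT2 (F n))).
pose g n : isoEmb (gh_space (gh_repr (q n))) (Z n) :=
  sval (projT2 (projT2 (projT2 (F n)))).
have fgP n : ~ V (q n) /\ np_bound n _ (Z n) (f n) (g n) :=
  svalP (projT2 (projT2 (projT2 (F n)))).
have [n [M [f' [g' [roots fell_lt d_lt]]]]] := root_matching d_erm tau_stable
  (fun n => (fgP n).2.1) (fun n => (fgP n).2.2) e0.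
apply: (fgP n).1; apply: pV.
(* The common image of the two roots is taken as the root of [M]. *)
apply: (@le_lt_trans _ _ (maxe
  (fell_dist (range f') (f' (gh_root (gh_repr p))) (range g')
     (f' (gh_root (gh_repr p))))
  (d M (smap f' (gh_elt (gh_repr p)), f' (gh_root (gh_repr p)))
     (smap g' (gh_elt (gh_repr (q n))), f' (gh_root (gh_repr p))))%:E)).
  by apply: ereal_inf_lbound; exists M, (f' (gh_root (gh_repr p))), f', g'.
by rewrite gt_max lte_fin; apply/andP; split; rewrite {2}roots.
Qed.
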